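(* A cubic fourfold $Y\subset\mathbb{P}^5$ singular along a rational normal curve of degree $5$ is determinantal. In particular, $Y$ is also singular along a line.
   Context: We work over $\mathbb{C}$. A cubic fourfold is a hypersurface in $\mathbb{P}^5$ given by a nonzero cubic form. It is called determinantal if its equation is the determinant of a $3\times3$ matrix of linear forms in $x_0,\dots,x_5$. *)

(* Defs.v *)
From HB Require Import structures.
From mathcomp Require Import all_boot all_order all_algebra.
From mathcomp Require Import complex mpoly.
From mathcomp Require Import reals.

Set Implicit Arguments.
Unset Strict Implicit.
Unset Printing Implicit Defensive.

Import GRing.Theory.
Local Open Scope ring_scope.

(* Points of P^n are given by nonzero row vectors of homogeneous coordinates.  *)
(* A subset of P^n is a predicate on row vectors describing its punctured      *)
(* affine cone.  The hypersurface V(F) is represented by its equation F.       *)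

Section ProjectiveGeometry.
Variables (K : fieldType) (n : nat).
Implicit Types (F : {mpoly K[n.+1]}) (x : 'rV[K]_n.+1).
Implicit Types (Z : 'rV[K]_n.+1 -> Prop).

Definition singular_at F x : Prop :=
  F.@[x 0] = 0 /\ forall i : 'I_n.+1, F^`M(i).@[x 0] = 0.

Definition singular_along F Z : Prop := forall x, Z x -> singular_at F x.

Definition veronese (s t : K) : 'rV[K]_n.+1 :=
  \row_(i < n.+1) (s ^+ (n - i) * t ^+ i).

(* The image of P^1 under (s : t) |-> (s^n : s^(n-1) t : ... : t^n), up to a   *)
(* projective change of coordinates A; c accounts for the choice of            *)
(* homogeneous coordinates.                                                    *)
Definition rational_normal_curve Z : Prop :=
  exists2 A : 'M[K]_n.+1, A \in unitmx &
    forall x, Z x <->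
      exists s t c : K,
        [/\ (s, t) != (0, 0), c != 0 & x = c *: (veronese s t *m A)].

(* The projectivization of a 2-dimensional subspace (the row space of A).      *)
Definition projective_line Z : Prop :=
  exists2 A : 'M[K]_(2, n.+1), row_free A &
    forall x, Z x <-> x != 0 /\ (x <= A)%MS.

(* Note that 0 is 1.-homog, so zero entries are allowed. *)
Definition determinantal_cubic F : Prop :=
  exists2 M : 'M[{mpoly K[n.+1]}]_3,
    forall i j, M i j \is 1.-homog & F = \det M.

End ProjectiveGeometry.

(* Main.v *)
(* After the change of coordinates Y = X A^-1 the curve C is the standard one.
   Let T be the symmetric trilinear form of F in these coordinates.  The partial
   derivatives of F vanish along C exactly when T(i,j,k) sums to 0 over each
   antidiagonal j + k = d.  These linear equations leave one degree of freedom
   in each of the weights i + j + k = 6, 7, 8, 9 and none in the others, so F is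
   a combination of the four maximal minors of the Hankel matrix
   H = (Y_(i+j)), i < 3, j < 4; that is, F = det (c / H) with a constant row c.
   Column operations turn c into (u, 0, 0, 0), which leaves a 3 x 3 determinant.
   For the line, choose a binary quadratic form q <> 0 with
   sum_k q_k c_(l+k) = 0 for l < 2.  At the points with
   sum_k q_k Y_(l+k) = 0 for l < 4, which contain a line, the matrix (c / H)
   kills the two columns given by multiplication by q; it has rank at most 2
   there, so its determinant is singular.  (The line is the secant or tangent of C
   spanned by the zeros of q.) *)

Require Import Defs.
From HB Require Import structures.
From mathcomp Require Import all_boot all_order all_algebra.
From mathcomp Require Import complex mpoly.
From mathcomp Require Import reals.
From mathcomp Require Import ring zify.

Set Implicit Arguments.
Unset Strict Implicit.
Unset Printing Implicit Defensive.

Import GRing.Theory Num.Theory.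
Local Open Scope ring_scope.

(** * Symmetric tensors with vanishing antidiagonal sums *)

Definition sorted_app (A : Type) (t : nat -> nat -> nat -> A) i j k :=
  let s := sort leq [:: i; j; k] in t (nth 0 s 0) (nth 0 s 1) (nth 0 s 2).

Definition symmetric3 (A : Type) (t : nat -> nat -> nat -> A) :=
  (forall i j k, t i j k = t j i k) /\ (forall i j k, t i j k = t i k j).

Lemma sorted_appE (A : Type) (t : nat -> nat -> nat -> A) i j k :
  symmetric3 t -> sorted_app t i j k = t i j k.
Proof.
case=> t12 t23; rewrite /sorted_app /sort /=.
have t13 a b c : t a b c = t c b a by rewrite t12 t23 t12.
have t231 a b c : t a b c = t b c a by rewrite t12 t23.
case: (leqP i j) => ij; case: (leqP i k) => ik; case: (leqP j k) => jk //=;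
  rewrite ?ij ?ik ?jk ?(leqNgt i k, leqNgt j k) ?ik ?jk //=.
all: by [rewrite t12|rewrite t23|rewrite t13|rewrite t231|rewrite -t231|lia].
Qed.

Definition antidiag0 (K : nmodType) (t : nat -> nat -> nat -> K) :=
  forall i d, (i < 6)%N -> (d <= 10)%N ->
    \sum_(0 <= j < 6) \sum_(0 <= k < 6) t i j k *+ (j + k == d) = 0.

Lemma antidiag0_rev (K : nmodType) (t : nat -> nat -> nat -> K) :
  symmetric3 t -> antidiag0 t ->
  antidiag0 (fun i j k => t (5 - k) (5 - j) (5 - i))%N.
Proof.
case=> t12 t23 t0 i d i_lt d_le.
rewrite -[RHS](t0 (5 - i)%N (10 - d)%N); [|lia|lia].
rewrite big_nat_rev; apply: eq_big_nat => j j_lt.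
rewrite big_nat_rev; apply: eq_big_nat => k k_lt.
rewrite t23 t12 t23; congr (t _ _ _ *+ nat_of_bool _); lia.
Qed.

Lemma eq_of_scaled_subr (K : numFieldType) n (x y e : K) :
  e = 0 -> n.+1%:R * (x - y) = e -> x = y.
Proof.
move=> -> /eqP; rewrite mulf_eq0 pnatr_eq0 /= subr_eq0.
by move/eqP.
Qed.

Section HankelRelations.
Local Open Scope nat_scope.

(* The entries of weight i + j + k <= 7 of the symmetric tensor whose cubic form
   is 6 (a M_012 + b M_013 + ...), M_ijk being the minor of the Hankel matrix on
   columns i, j, k.  Reversing i |-> 5 - i gives those of weight >= 8. *)
Definition hankel_table (K : zmodType) (t : nat -> nat -> nat -> K) : Type :=
  let a := t 0 2 4 in let b := t 0 2 5 in
  ((t 0 0 0 = 0%R) * (t 0 0 1 = 0%R) * (t 0 0 2 = 0%R) * (t 0 1 1 = 0%R) *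
   (t 0 0 3 = 0%R) * (t 0 1 2 = 0%R) * (t 1 1 1 = 0%R) * (t 0 0 4 = 0%R) *
   (t 0 1 3 = 0%R) * (t 0 2 2 = 0%R) * (t 1 1 2 = 0%R) * (t 0 0 5 = 0%R) *
   (t 0 1 4 = 0%R) * (t 0 2 3 = 0%R) * (t 1 1 3 = 0%R) * (t 1 2 2 = 0%R) *
   (t 0 1 5 = 0%R) *
   (t 0 3 3 = (- a *+ 2)%R) * (t 1 1 4 = (- a *+ 2)%R) *
   (t 1 2 3 = (a *+ 2)%R) *
   (t 2 2 2 = (- a *+ 6)%R) *
   (t 0 3 4 = (- b)%R) * (t 1 1 5 = (- b *+ 2)%R) * (t 1 2 4 = b) *
   (t 1 3 3 = (b *+ 2)%R) * (t 2 2 3 = (- b *+ 2)%R))%type.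

Lemma hankel_relations (K : numFieldType) (t : nat -> nat -> nat -> K) :
  symmetric3 t -> antidiag0 t -> hankel_table t.
Proof.
move=> t_sym t0; rewrite /hankel_table.
move Da: (t 0 2 4) => a; move Db: (t 0 2 5) => b.
have E i d : i < 6 -> d <= 10 ->
  (\sum_(0 <= j < 6) \sum_(0 <= k < 6)
     sorted_app t i j k *+ (j + k == d) = 0)%R.
  move=> i_lt d_le; rewrite -[RHS](t0 i d i_lt d_le).
  by apply: eq_bigr => j _; apply: eq_bigr => k _; rewrite sorted_appE.
Ltac solve_in E n i d :=
  apply: (@eq_of_scaled_subr _ n _ _ _ (E i d isT isT));
  rewrite unlock /= !(mulr0n,mulr1n,addr0,add0r) /sorted_app /=;
  repeat match goal with H : ?t ?i ?j ?k = _ |- _ => rewrite H end;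
  ring.
have t000 : t 0 0 0 = 0%R by solve_in E 0 0 0.
have t001 : t 0 0 1 = 0%R by solve_in E 0 1 0.
have t002 : t 0 0 2 = 0%R by solve_in E 0 2 0.
have t011 : t 0 1 1 = 0%R by solve_in E 0 0 2.
have t003 : t 0 0 3 = 0%R by solve_in E 0 3 0.
have t012 : t 0 1 2 = 0%R by solve_in E 1 2 1.
have t111 : t 1 1 1 = 0%R by solve_in E 0 1 2.
have t004 : t 0 0 4 = 0%R by solve_in E 0 4 0.
have t013 : t 0 1 3 = 0%R by solve_in E 1 3 1.
have t022 : t 0 2 2 = 0%R by solve_in E 0 0 4.
have t112 : t 1 1 2 = 0%R by solve_in E 0 2 2.
have t005 : t 0 0 5 = 0%R by solve_in E 0 5 0.
have t014 : t 0 1 4 = 0%R by solve_in E 1 4 1.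
have t023 : t 0 2 3 = 0%R by solve_in E 1 0 5.
have t113 : t 1 1 3 = 0%R by solve_in E 0 3 2.
have t122 : t 1 2 2 = 0%R by solve_in E 1 2 3.
have t015 : t 0 1 5 = 0%R by solve_in E 1 5 1.
have t033 : (t 0 3 3 = - a *+ 2)%R by solve_in E 0 0 6.
have t114 : (t 1 1 4 = - a *+ 2)%R by solve_in E 0 4 2.
have t123 : (t 1 2 3 = a *+ 2)%R by solve_in E 1 3 3.
have t222 : (t 2 2 2 = - a *+ 6)%R by solve_in E 0 2 4.
have t034 : (t 0 3 4 = - b)%R by solve_in E 1 0 7.
have t115 : (t 1 1 5 = - b *+ 2)%R by solve_in E 0 5 2.
have t124 : (t 1 2 4 = b)%R by solve_in E 1 4 3.
have t223 : (t 2 2 3 = - b *+ 2)%R by solve_in E 1 2 5.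
have t133 : (t 1 3 3 = b *+ 2)%R by solve_in E 1 3 4.
do !split=> //.
Qed.

End HankelRelations.

Definition bordered_hankel (A : Type) (c y : nat -> A) : 'M[A]_4 :=
  \matrix_(i, j) (if val i is i'.+1 then y (i' + j)%N else c j).

Lemma det_mx33 (A : comNzRingType) (m : nat -> nat -> A) :
  \det (\matrix_(i < 3, j < 3) m i j) =
    m 0%N 0%N * (m 1%N 1%N * m 2%N 2%N - m 1%N 2%N * m 2%N 1%N)
  - m 0%N 1%N * (m 1%N 0%N * m 2%N 2%N - m 1%N 2%N * m 2%N 0%N)
  + m 0%N 2%N * (m 1%N 0%N * m 2%N 1%N - m 1%N 1%N * m 2%N 0%N).
Proof.
rewrite (expand_det_row _ ord0) !big_ord_recl big_ord0 /cofactor.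
rewrite !(expand_det_row _ ord0) !big_ord_recl !big_ord0 /cofactor !det_mx11.
by rewrite !mxE /= /bump /=; ring.
Qed.

Lemma sum_antidiag0_det (K : numFieldType) (A : comNzRingType)
    (f : {rmorphism K -> A}) (t : nat -> nat -> nat -> K) (y : nat -> A) :
  symmetric3 t -> antidiag0 t ->
  let c := nth 0 [:: t 1 3 5; - t 0 3 5; t 0 2 5; - t 0 2 4]%N in
  \sum_(0 <= i < 6) \sum_(0 <= j < 6) \sum_(0 <= k < 6)
    f (t i j k) * (y i * y j * y k)
  = 6%:R * \det (bordered_hankel (f \o c) y).
Proof.
move=> t_sym t0 c.
have [t12 t23] := t_sym.
have tab := hankel_relations t_sym t0.
have := hankel_relations _ (antidiag0_rev t_sym t0).
rewrite /hankel_table /subn /= => tab'.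
have {}tab' := tab' (conj (fun i j k => t23 _ _ _) (fun i j k => t12 _ _ _)).
transitivity (\sum_(0 <= i < 6) \sum_(0 <= j < 6) \sum_(0 <= k < 6)
    f (sorted_app t i j k) * (y i * y j * y k)).
  by do 3!(apply: eq_bigr => ? _); rewrite sorted_appE.
have minorE j : row' ord0 (col' j (bordered_hankel (f \o c) y)) =
    \matrix_(i < 3, k < 3) y (i + bump j k)%N.
  by apply/matrixP => i k; rewrite !mxE.
rewrite (expand_det_row _ ord0) !big_ord_recl big_ord0 /cofactor !minorE.
rewrite !(det_mx33 (fun i j => y (i + bump _ j)%N)) !mxE /= /bump /=.
rewrite unlock /= /sorted_app /= !tab !tab' /c /=.
ring.
Qed.

(** * Determinants of matrices of polynomials *)

Lemma minorE (A : Type) m n (M : 'M[A]_(m.+1, n.+1)) i j k l :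
  row' i (col' j M) k l = M (lift i k) (lift j l).
Proof. by rewrite !mxE. Qed.

Lemma singular_at_scale (K : fieldType) n (F : {mpoly K[n.+1]}) a x :
  singular_at F x -> singular_at (a *: F) x.
Proof.
by case=> Fx dFx; split=> [|i]; rewrite ?mderivZ mevalZ ?Fx ?dFx mulr0.
Qed.

Lemma singular_at_sum (K : fieldType) n (I : Type) (r : seq I)
    (G : I -> {mpoly K[n.+1]}) x :
  (forall i, singular_at (G i) x) -> singular_at (\sum_(i <- r) G i) x.
Proof.
move=> Gx; split=> [|j].
  by rewrite (raddf_sum (meval _)) big1 // => i _; case: (Gx i).
rewrite (raddf_sum (mderiv j)) (raddf_sum (meval _)) big1 // => i _.
by case: (Gx i) => _; apply.
Qed.

Lemma singular_at_mul (K : fieldType) n (p q : {mpoly K[n.+1]})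
    (x : 'rV[K]_n.+1) :
  p.@[x 0] = 0 -> q.@[x 0] = 0 -> singular_at (p * q) x.
Proof.
move=> px qx; split=> [|i]; rewrite ?mderivM ?mevalD !mevalM px qx.
  by rewrite mulr0.
by rewrite mulr0 mul0r addr0.
Qed.

(* Column operations over K make the last two columns vanish at x, and every
   term of the Laplace expansion is then a product of two polynomials vanishing
   at x. *)
Lemma singular_at_det (K : fieldType) n m (M : 'M[{mpoly K[n.+1]}]_m.+2)
    (x : 'rV[K]_n.+1) :
  (\rank (map_mx (meval (x 0%R)) M) <= m)%N -> singular_at (\det M) x.
Proof.
set Mx := map_mx _ M => rk_Mx.
pose g := invmx (row_ebase Mx).
pose N := M *m map_mx (mpolyC n.+1 (R := K)) g.
have detM : \det M = \det (row_ebase Mx) *: \det N.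
  rewrite det_mulmx det_map_mx -mul_mpolyC mulrCA -rmorphM -det_mulmx.
  by rewrite mulmxV ?row_ebase_unit // det1 mulr1.
have Nx (j : 'I_m.+2) : (m <= j)%N -> forall i, (N i j).@[x 0] = 0.
  move=> le_mj i.
  have -> : (N i j).@[x 0] = map_mx (meval (x 0)) N i j by rewrite !mxE.
  rewrite map_mxM -/Mx -map_mx_comp.
  have -> : map_mx (meval (x 0) \o mpolyC n.+1 (R := K)) g = g.
    by apply/matrixP=> ? ?; rewrite !mxE /= mevalC.
  rewrite -{1}(mulmx_ebase Mx) mulmxK ?row_ebase_unit // mxE big1 // => k _.
  rewrite [pid_mx _ k j]mxE.
  case: eqP => [->|]; last by rewrite mulr0.
  by rewrite ltnNge (leq_trans rk_Mx) // mulr0.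
rewrite detM; apply: singular_at_scale; rewrite (expand_det_col _ ord_max).
apply: singular_at_sum => i; apply: singular_at_mul; first by rewrite Nx /=.
rewrite /cofactor mevalM [X in _ * X](_ : _ = 0) ?mulr0 //.
rewrite (expand_det_col _ ord_max) raddf_sum /= big1 // => k _.
by rewrite mevalM minorE Nx ?mul0r //= /bump; lia.
Qed.

Lemma row_free_submx (K : fieldType) m n r (U : 'M[K]_(m, n)) :
  (r <= \rank U)%N -> exists2 A : 'M[K]_(r, n), row_free A & (A <= U)%MS.
Proof.
move=> le_rU; exists (pid_mx r *m row_base U).
  by rewrite /row_free mxrankMfree ?row_base_free // rank_pid_mx.
by rewrite (submx_trans (submxMl _ _)) ?eq_row_base.
Qed.

Lemma linear_mx_scale_det (K : fieldType) n m a
    (N : 'M[{mpoly K[n]}]_m.+1) :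
  (forall i j, N i j \is 1.-homog) ->
  exists2 M : 'M[{mpoly K[n]}]_m.+1,
    forall i j, M i j \is 1.-homog & a *: \det N = \det M.
Proof.
move=> N1.
pose d := \row_(i < m.+1) (if i == 0 then a%:MP else 1 : {mpoly K[n]}).
exists (diag_mx d *m N) => [i j|].
  rewrite mul_diag_mx !mxE; case: ifP => _; last by rewrite mul1r.
  by rewrite mul_mpolyC dhomogZ.
rewrite det_mulmx det_diag big_ord_recl big1 ?mulr1 => [|i _]; rewrite mxE //=.
by rewrite mul_mpolyC.
Qed.

Lemma det_constant_row (K : fieldType) n m (M : 'M[{mpoly K[n]}]_m.+2)
    (c : 'rV[K]_m.+2) :
  c != 0 -> (forall j, M 0 j = (c 0 j)%:MP) ->
  (forall i j, i != 0 -> M i j \is 1.-homog) ->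
  exists2 N : 'M[{mpoly K[n]}]_m.+1,
    forall i j, N i j \is 1.-homog & \det M = \det N.
Proof.
move=> c0 Mc M1.
pose g := invmx (row_ebase c).
pose N := M *m map_mx (mpolyC n (R := K)) g.
have detM : \det M = \det (row_ebase c) *: \det N.
  rewrite det_mulmx det_map_mx -mul_mpolyC mulrCA -rmorphM -det_mulmx.
  by rewrite mulmxV ?row_ebase_unit // det1 mulr1.
have N0 j : N 0 j = ((c *m g) 0 j)%:MP.
  rewrite !mxE raddf_sum /=; apply: eq_bigr => k _.
  by rewrite Mc mxE -rmorphM.
have cg0 j : j != 0 -> (c *m g) 0 j = 0.
  move=> j0; rewrite -{1}(mulmx_ebase c) mulmxK ?row_ebase_unit // mxE.
  rewrite big1 // => k _.
  rewrite [pid_mx _ k j]mxE ord1 eq_sym.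
  by have /negPf -> : val j != 0%N by []; rewrite mulr0.
have N1 i j : i != 0 -> N i j \is 1.-homog.
  move=> i0; rewrite mxE rpred_sum // => k _.
  by rewrite mxE mulrC mul_mpolyC dhomogZ // M1.
have -> : \det M =
    (\det (row_ebase c) * (c *m g) 0 0) *: \det (row' 0 (col' 0 N)).
  rewrite detM (expand_det_row N 0) big_ord_recl big1 => [|j _].
    by rewrite addr0 /cofactor expr0 mul1r N0 mul_mpolyC scalerA.
  by rewrite N0 cg0 ?mpolyC0 ?mul0r.
apply: linear_mx_scale_det => i j.
by rewrite minorE N1.
Qed.

(** * The secant line *)

(* The matrix of multiplication by the binary quadratic form q. *)
Definition band_mx (K : fieldType) (q : 'rV[K]_3) n m : 'M[K]_(n, m) :=
  \matrix_(j, l) \sum_(k < 3) q 0 k *+ (j == l + k :> nat)%N.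

Lemma sum_band_mx (K : fieldType) (q : 'rV[K]_3) n m (f : nat -> K) (l : 'I_m) :
  (l + 2 < n)%N ->
  \sum_(j < n) f j * band_mx q n m j l = \sum_(k < 3) f (l + k)%N * q 0 k.
Proof.
move=> l_lt; under eq_bigr do rewrite mxE mulr_sumr.
rewrite exchange_big; apply: eq_bigr => k _ /=.
have lk_lt : (l + k < n)%N by have := ltn_ord k; lia.
rewrite (bigD1 (Ordinal lk_lt)) //= eqxx mulr1n big1 ?addr0 // => j.
by rewrite -val_eqE /= => /negPf ->; rewrite mulr0n mulr0.
Qed.

Lemma rank_band_mx (K : fieldType) (q : 'rV[K]_3) :
  q != 0 -> \rank (band_mx q 4 2) = 2%N.
Proof.
move=> q0; rewrite -mxrank_tr; apply/eqP; rewrite -/(row_free _) -kermx_eq0.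
apply/rowV0P => v /sub_kermxP vQ.
have e (j : 'I_4) : v 0 0 * band_mx q 4 2 j 0 + v 0 1 * band_mx q 4 2 j 1 = 0.
  move/matrixP/(_ 0 j): vQ; rewrite [RHS]mxE => <-.
  have QT l : (band_mx q 4 2)^T l j = band_mx q 4 2 j l by rewrite mxE.
  rewrite [RHS]mxE !big_ord_recl big_ord0 addr0 !QT.
  by have -> : lift ord0 ord0 = 1 :> 'I_2 by apply: val_inj.
have := e 3; have := e 2; have := e 1; have := e 0.
rewrite !mxE !big_ord_recl !big_ord0 /= !(mulr0n, mulr1n, addr0, add0r).
rewrite !(mulr0, addr0, add0r).
set a := v 0 0; set b := v 0 1.
move=> aq0 abq1 abq2 bq2.
suff /andP[/eqP a0 /eqP b0] : (a == 0) && (b == 0).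
  apply/rowP => l; rewrite mxE; case: (unliftP 0 l) => [l'|] -> //.
  by rewrite -b0 ord1; congr (v _ _); apply: val_inj.
apply: contraNT q0 => /nandP ab0.
suff [q_0 q_1 q_2] : [/\ q 0 ord0 = 0, q 0 (lift ord0 ord0) = 0
                       & q 0 (lift ord0 (lift ord0 ord0)) = 0].
  apply/eqP/rowP => -[[|[|[|//]]] k_lt]; rewrite mxE.
  - by rewrite -[RHS]q_0; congr (q _ _); apply: val_inj.
  - by rewrite -[RHS]q_1; congr (q _ _); apply: val_inj.
  - by rewrite -[RHS]q_2; congr (q _ _); apply: val_inj.
have mul0 (u x : K) : u != 0 -> u * x = 0 -> x = 0.
  by move=> u0 /eqP; rewrite mulf_eq0 (negPf u0) => /eqP.
case: ab0 => [/mul0 a0|/mul0 b0].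
  have q_0 := a0 _ aq0.
  have q_1 : q 0 (lift ord0 ord0) = 0.
    by apply: a0; rewrite -abq1 q_0 mulr0 addr0.
  by split=> //; apply: a0; rewrite -abq2 q_1 mulr0 addr0.
have q_2 := b0 _ bq2.
have q_1 : q 0 (lift ord0 ord0) = 0 by apply: b0; rewrite -abq2 q_2 mulr0 add0r.
by split=> //; apply: b0; rewrite -abq1 q_1 mulr0 add0r.
Qed.

Lemma hankel_line (K : fieldType) (c : nat -> K) :
  exists2 B : 'M[K]_(2, 6), row_free B &
    forall z : 'rV_6, (z <= B)%MS ->
      (\rank (bordered_hankel c (fun k => z 0%R (inord k))) <= 2)%N.
Proof.
pose H : 'M_(3, 2) := \matrix_(k, l) c (l + k)%N.
have [|q qfree /sub_kermxP qH] := @row_free_submx _ _ _ 1 (kermx H).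
  by rewrite mxrank_ker; have := rank_leq_col H; lia.
have q0 : q != 0 by rewrite -mxrank_eq0 (eqP qfree).
have [|B Bfree BU] := @row_free_submx _ _ _ 2 (kermx (band_mx q 6 4)).
  by rewrite mxrank_ker; have := rank_leq_col (band_mx q 6 4); lia.
exists B => // z zB.
have /sub_kermxP zq := submx_trans zB BU.
set D := bordered_hankel _ _.
have DQ : D *m band_mx q 4 2 = 0.
  apply/matrixP => i l; rewrite mxE [RHS]mxE.
  case: (unliftP ord0 i) => [i'|] ->.
    have z_l (m : 'I_4) : \sum_(k < 3) z 0 (inord (m + k)) * q 0 k = 0.
      have m_lt := ltn_ord m.
      rewrite -(sum_band_mx q (n := 6) (fun k => z 0 (inord k))); last by lia.
      have := congr1 (fun M : 'M_(_, _) => M 0 m) zq.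
      rewrite mxE [RHS]mxE => zqm; rewrite -[RHS]zqm; apply: eq_bigr => j _.
      by rewrite inord_val.
    under eq_bigr do rewrite [D _ _]mxE /=.
    have l_lt := ltn_ord l; have i_lt := ltn_ord i'.
    rewrite (sum_band_mx q (fun j => z 0 (inord (i' + j)))); last by lia.
    have il : (i' + l < 4)%N by lia.
    rewrite -[RHS](z_l (Ordinal il)); apply: eq_bigr => k _.
    by rewrite addnA.
  under eq_bigr do rewrite [D _ _]mxE /=.
  rewrite (sum_band_mx q c); last by have := ltn_ord l; lia.
  have := congr1 (fun M : 'M_(_, _) => M 0 l) qH.
  rewrite mxE [RHS]mxE => qHl; rewrite -[RHS]qHl; apply: eq_bigr => k _.
  by rewrite mxE mulrC.
have := mulmx0_rank_max DQ; rewrite rank_band_mx //; lia.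
Qed.

(** * Polarization *)

Section Euler.
Variables (K : fieldType) (n : nat).
Implicit Types p : {mpoly K[n]}.

Lemma dhomog_mderiv p d i : p \is d.+1.-homog -> p^`M(i) \is d.-homog.
Proof.
move=> hp; apply/dhomogP => m; rewrite mcoeff_msupp mcoeff_deriv => m0.
have : (m + U_(i))%MM \in msupp p.
  by rewrite mcoeff_msupp; apply: contraNneq m0 => ->; rewrite mul0rn.
by move/(dhomog_mf hp) => /=; rewrite mdegD mdeg1 addn1 => -[].
Qed.

Lemma mpoly_euler p d :
  p \is d.-homog -> \sum_i 'X_i * p^`M(i) = d%:R *: p.
Proof.
move=> hp; rewrite [RHS]scaler_nat [in RHS](mpolyE p) -sumrMnl.
transitivity (\sum_(m <- msupp p) \sum_i p@_m *: ('X_i * 'X_[m]^`M(i))).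
  rewrite exchange_big; apply: eq_bigr => i _ /=.
  rewrite {1}(mpolyE p) raddf_sum mulr_sumr; apply: eq_bigr => m _ /=.
  by rewrite mderivZ scalerAr.
apply: eq_big_seq => m mp; rewrite -scaler_sumr scalerMnr; congr (_ *: _).
rewrite -(dhomog_mf hp mp) /= mdegE -sumrMnr; apply: eq_bigr => i _.
rewrite mderivX -scalerAr -mpolyXD scaler_nat.
have [->|mi] := posnP (m i); first by rewrite !mulr0n.
by rewrite addmC submK // lep1mP -lt0n.
Qed.

Lemma dhomog0_mpolyC p : p \is 0.-homog -> p = (p@_0)%:MP.
Proof.
move=> hp; apply/mpolyP => m; rewrite mcoeffC.
have [->|m0] := eqVneq m 0%MM; first by rewrite mulr1.
by rewrite mulr0 (dhomog_nemf_coeff hp) //= mdeg_eq0.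
Qed.

Variable A : 'M[K]_n.

Definition dir_deriv a p := \sum_i A a i *: p^`M(i).
Definition coord_form a : {mpoly K[n]} := \sum_i invmx A i a *: 'X_i.

Lemma dir_derivC a b p :
  dir_deriv a (dir_deriv b p) = dir_deriv b (dir_deriv a p).
Proof.
rewrite /dir_deriv.
under eq_bigr do rewrite (raddf_sum (mderiv _)) scaler_sumr /=.
under [RHS]eq_bigr do rewrite (raddf_sum (mderiv _)) scaler_sumr /=.
rewrite exchange_big; apply: eq_bigr => i _; apply: eq_bigr => j _ /=.
by rewrite !mderivZ !scalerA mulrC mderiv_comm.
Qed.

Lemma dhomog_dir_deriv a p d : p \is d.+1.-homog -> dir_deriv a p \is d.-homog.
Proof.
by move=> hp; apply: rpred_sum => i _; rewrite rpredZ ?dhomog_mderiv.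
Qed.

Lemma dhomog_coord_form a : coord_form a \is 1.-homog.
Proof. by apply: rpred_sum => i _; rewrite rpredZ // dhomogX /= mdeg1. Qed.

Lemma meval_coord_form a (x : 'rV[K]_n) :
  (coord_form a).@[x 0] = (x *m invmx A) 0 a.
Proof.
rewrite mxE (raddf_sum (meval _)); apply: eq_bigr => i _.
by rewrite /= mevalZ mevalXU mulrC.
Qed.

Hypothesis A_unit : A \in unitmx.

Lemma dir_euler p d :
  p \is d.-homog -> \sum_a coord_form a * dir_deriv a p = d%:R *: p.
Proof.
move=> hp; rewrite -(mpoly_euler hp).
under eq_bigr do rewrite mulr_suml.
rewrite exchange_big; apply: eq_bigr => i _ /=.
under eq_bigr do rewrite mulr_sumr.
rewrite exchange_big (bigD1 i) //= [X in _ + X]big1 ?addr0 => [|j ji];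
  under eq_bigr do rewrite -scalerAl -scalerAr scalerA.
  rewrite -scaler_suml; have := mulVmx A_unit.
  by move/matrixP/(_ i i); rewrite !mxE eqxx => ->; rewrite scale1r.
rewrite -scaler_suml; have := mulVmx A_unit.
by move/matrixP/(_ i j); rewrite !mxE eq_sym (negPf ji) => ->; rewrite scale0r.
Qed.

Definition polarization p a b c :=
  (dir_deriv c (dir_deriv b (dir_deriv a p)))@_0.

Lemma quadric_polarization p a : p \is 3.-homog ->
  2%:R *: dir_deriv a p = \sum_b \sum_c
     (polarization p a b c)%:MP * (coord_form b * coord_form c).
Proof.
move=> hp; have h2 := dhomog_dir_deriv a hp; rewrite -(dir_euler h2).
apply: eq_bigr => b _; have h1 := dhomog_dir_deriv b h2.
rewrite -[dir_deriv b _]scale1r -(dir_euler h1) mulr_sumr.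
apply: eq_bigr => c _.
by rewrite mulrA mulrC {1}(dhomog0_mpolyC (dhomog_dir_deriv c h1)).
Qed.

Lemma cubic_polarization p : p \is 3.-homog ->
  6%:R *: p = \sum_a \sum_b \sum_c
     (polarization p a b c)%:MP * (coord_form a * coord_form b * coord_form c).
Proof.
move=> hp; have -> : 6%:R = 2%:R * 3%:R :> K by rewrite -natrM.
rewrite -scalerA -(dir_euler hp) scaler_sumr.
apply: eq_bigr => a _; rewrite scalerAr quadric_polarization // mulr_sumr.
apply: eq_bigr => b _; rewrite mulr_sumr; apply: eq_bigr => c _.
by rewrite mulrCA !mulrA.
Qed.
End Euler.

Lemma sum_inord (V : nmodType) n (f : 'I_n.+1 -> V) :
  \sum_(0 <= i < n.+1) f (inord i) = \sum_i f i.
Proof. by rewrite big_mkord; apply: eq_bigr => i _; rewrite inord_val. Qed.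

Lemma poly_eq0_horner (K : numDomainType) (p : {poly K}) :
  (forall a, p.[a] = 0) -> p = 0.
Proof.
move=> p0; apply: contraTeq isT => p_neq0.
have := @max_poly_roots _ p [seq i%:R | i <- iota 0 (size p)] p_neq0.
rewrite size_map size_iota ltnn; apply.
  by apply/allP => a _; rewrite /root p0.
rewrite map_inj_uniq ?iota_uniq // => i j /eqP.
by rewrite eqr_nat => /eqP.
Qed.

Lemma antidiag_sum0 (K : numDomainType) n (t : 'I_n -> 'I_n -> K) :
  (forall a, \sum_j \sum_k t j k * (a ^+ j * a ^+ k) = 0) ->
  forall d, \sum_j \sum_k t j k *+ (j + k == d)%N = 0.
Proof.
move=> t0 d; pose p := \sum_(j < n) \sum_(k < n) (t j k)%:P * 'X^(j + k).
have p0 : p = 0.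
  apply: poly_eq0_horner => a; rewrite horner_sum -[RHS](t0 a).
  apply: eq_bigr => j _; rewrite horner_sum; apply: eq_bigr => k _.
  by rewrite hornerM hornerC hornerXn exprD.
have pd : p`_d = 0 by rewrite p0 coef0.
rewrite -[RHS]pd coef_sum; apply: eq_bigr => j _.
rewrite coef_sum; apply: eq_bigr => k _.
by rewrite coefCM coefXn eq_sym mulr_natr.
Qed.

Lemma polarization_symmetric (K : fieldType) n (A : 'M[K]_n.+1) p :
  symmetric3 (fun i j k => polarization A p (inord i) (inord j) (inord k)).
Proof.
split=> i j k; rewrite /polarization; last by rewrite dir_derivC.
by rewrite (dir_derivC A (inord j)).
Qed.

Lemma cubic_singular_along_rnc (K : numFieldType) (F : {mpoly K[6]})
    (C : 'rV[K]_6 -> Prop) :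
  F != 0 -> F \is 3.-homog -> rational_normal_curve C -> singular_along F C ->
  determinantal_cubic F /\
  exists2 L : 'rV[K]_6 -> Prop, projective_line L & singular_along F L.
Proof.
move=> F_neq0 F_cubic [A A_unit CE] F_sing.
have F_singA a : singular_at F (veronese 5 1 a *m A).
  apply: F_sing; apply/CE; exists 1, a, 1; split; last by rewrite scale1r.
    by rewrite xpair_eqE oner_eq0.
  exact: oner_neq0.
pose t i j k := polarization A F (inord i) (inord j) (inord k).
pose y k := coord_form A (inord k).
have t0 : antidiag0 t.
  move=> i d _ _.
  rewrite -[RHS](antidiag_sum0 (t := polarization A F (inord i)) _ d) => [|a].
    rewrite -sum_inord; apply: eq_big_nat => j /andP[_ j_lt].
    rewrite -sum_inord; apply: eq_big_nat => k /andP[_ k_lt].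
    by rewrite !inordK.
  have : (2%:R *: dir_deriv A (inord i) F).@[(veronese 5 1 a *m A) 0] = 0.
    rewrite mevalZ (raddf_sum (meval _)) big1 ?mulr0 // => j _ /=.
    by rewrite mevalZ (F_singA a).2 mulr0.
  rewrite quadric_polarization // => quad0; rewrite -[RHS]quad0.
  rewrite (raddf_sum (meval _)); apply: eq_bigr => j _.
  rewrite /= (raddf_sum (meval _)); apply: eq_bigr => k _.
  rewrite /= !mevalM mevalC !meval_coord_form mulmxK // !mxE.
  by rewrite !expr1n !mul1r.
pose c := nth 0 [:: t 1 3 5; - t 0 3 5; t 0 2 5; - t 0 2 4]%N.
have F_det : F = \det (bordered_hankel (mpolyC 6 (R := K) \o c) y).
  have six0 : (6%:R : K) != 0 by rewrite pnatr_eq0.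
  apply: (scalerI six0); rewrite (cubic_polarization A_unit F_cubic).
  rewrite [RHS]scaler_nat -mulr_natl.
  rewrite -sum_antidiag0_det //; last exact: polarization_symmetric.
  rewrite -sum_inord; apply: eq_bigr => i _.
  by rewrite -sum_inord; apply: eq_bigr => j _; rewrite -sum_inord.
have c_neq0 : \row_(j < 4) c j != 0.
  apply: contraNneq F_neq0 => c0.
  rewrite F_det (expand_det_row _ 0) big1 // => j _.
  by move/rowP/(_ j): c0; rewrite !mxE /= => ->; rewrite mpolyC0 mul0r.
have [||N N1 detN] := det_constant_row c_neq0
  (M := bordered_hankel (mpolyC 6 (R := K) \o c) y).
- by move=> j; rewrite !mxE.
- move=> i j; case: (unliftP 0 i) => [i'|] -> // _.
  by rewrite mxE /= dhomog_coord_form.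
split; first by exists N; rewrite // F_det.
have [B B_free BP] := hankel_line c.
exists (fun x => x != 0 /\ (x <= B *m A)%MS).
  by exists (B *m A) => //; rewrite /row_free mxrankMfree // row_free_unit.
move=> x [_ xBA]; rewrite F_det; apply: singular_at_det.
have {}xBA : (x *m invmx A <= B)%MS.
  by rewrite -(mulmxK A_unit B) submxMr.
apply: leq_trans (BP _ xBA); rewrite eq_leq //; congr (\rank _).
apply/matrixP => i j; rewrite !mxE; case: (val i) => [|i'] /=.
  by rewrite mevalC.
by rewrite meval_coord_form.
Qed.

Theorem lemma6p13 (R : realType) (F : {mpoly R[i][6]})
    (F_neq0 : F != 0) (F_cubic : F \is 3.-homog)
    (C : 'rV[R[i]]_6 -> Prop) (C_rnc : rational_normal_curve C)
    (F_singC : singular_along F C) :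
  determinantal_cubic F /\
  exists2 L : 'rV[R[i]]_6 -> Prop, projective_line L & singular_along F L.
Proof. exact: (cubic_singular_along_rnc F_neq0 F_cubic C_rnc F_singC). Qed.
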